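(* Let $r=\nu\delta^{\tau}$ and $r'=\nu'\delta^{\tau'}$ be monomials. The following rule holds: $$r\odot^\sharp r'=\begin{cases}(\nu-\nu')\,\delta^{\tau} & \text{if }\tau<\tau',\\ (\nu-\nu')\,\delta^{+\infty} & \text{otherwise,}\end{cases}$$ with the convention that $+\infty-\infty=-\infty$.
   Context: Let $\overline{\mathbb Z}=\mathbb Z\cup\{-\infty,+\infty\}$ with its standard order. A counter is a map $s:\overline{\mathbb Z}\to\overline{\mathbb Z}$ that is non-decreasing for the standard order and satisfies $s(-\infty)=-\infty$, $s(+\infty)=+\infty$; $\Sigma$ is the set of counters. Thus a counter is determined by its values on $\mathbb Z$. The order on $\Sigma$ is $s\preceq s'$ iff $s(t)\ge s'(t)$ (standard order, reversed) for all $t\in\mathbb Z$. The Hadamard product of $s_1,s_2\in\Sigma$ is the counter $s_1\odot s_2$ with $(s_1\odot s_2)(t)=s_1(t)+s_2(t)$ for all $t\in\mathbb Z$, where in this sum $(+\infty)+(-\infty)=+\infty$. For $y,a\in\Sigma$, $y\odot^\sharp a$ (the residual of the Hadamard product) denotes the greatest (for $\preceq$) counter $x\in\Sigma$ such that $a\odot x\preceq y$; it always exists. A monomial $n\delta^{t_0}$ (with coefficient $n\in\overline{\mathbb Z}$ and exponent $t_0\in\overline{\mathbb Z}$) denotes the counter with value $n$ at every $t\in\mathbb Z$ with $t\le t_0$ and $+\infty$ at every $t\in\mathbb Z$ with $t>t_0$. The convention in the claim says how to interpret the standard subtraction $\nu-\nu'$ when the coefficients are infinite.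
   Formalization: The rule fails for some ways of writing the constant +∞ counter r', so two conditions are added: if ν'=+∞ then τ'≤τ; and if τ'=−∞ then ν'=+∞ or ν=−∞. Exactly the failing cases are excluded (e.g. ν=5, ν'=3, τ'=−∞). *)

(* Defs.v *)
From mathcomp Require Import all_boot all_order all_algebra.
From mathcomp Require Import boolp classical_sets constructive_ereal.

Set Implicit Arguments.
Unset Strict Implicit.
Unset Printing Implicit Defensive.

Import Order.TTheory GRing.Theory Num.Theory.
Local Open Scope ring_scope.
Local Open Scope ereal_scope.

Notation Zbar := (\bar int).

Record counter := Counter {
  counter_fun :> Zbar -> Zbar;
  counter_homo : {homo counter_fun : x y / x <= y};
  counter_ninfty : counter_fun -oo = -oo;
  counter_pinfty : counter_fun +oo = +oo }.

Definition extendZ (f : int -> Zbar) (t : Zbar) : Zbar :=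
  match t with t%:E => f t | +oo => +oo | -oo => -oo end.

Lemma extendZ_homo (f : int -> Zbar) :
  {homo f : x y / (x <= y)%R >-> x <= y} ->
  {homo extendZ f : x y / x <= y}.
Proof.
by move=> hf [x| |] [y| |] //=; rewrite ?leey ?leNye // lee_fin; apply: hf.
Qed.

Definition counter_of (f : int -> Zbar)
    (hf : {homo f : x y / (x <= y)%R >-> x <= y}) : counter :=
  Counter (extendZ_homo hf) erefl erefl.

(* The order of counters is the reverse of the pointwise order. *)
Definition counter_le (s s' : counter) : Prop :=
  forall t : int, s' t%:E <= s t%:E.

Lemma counter_eqP (s s' : counter) :
  (forall t : int, s t%:E = s' t%:E) -> s = s'.
Proof.
case: s s' => [f hf fn fp] [g hg gn gp] /= fg.
have {}fg : f = g by apply: funext => -[t| |]; rewrite ?fn ?fp ?gn ?gp.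
by case: _ / fg hg gn gp => hg gn gp; congr Counter; apply: Prop_irrelevance.
Qed.

Lemma counter_le_anti (s s' : counter) :
  counter_le s s' -> counter_le s' s -> s = s'.
Proof.
by move=> h h'; apply: counter_eqP => t; apply: le_anti; rewrite h h'.
Qed.

Lemma hadamard_homo (s1 s2 : counter) :
  {homo (fun t : int => (s1 t%:E + s2 t%:E)%dE) :
    x y / (x <= y)%R >-> x <= y}.
Proof.
by move=> x y xy; apply: DualAddTheoryRealDomain.lee_dD; apply: counter_homo; rewrite lee_fin.
Qed.

(* The dual addition satisfies +oo + -oo = +oo, whereas the plain addition of
   extended numbers satisfies +oo + -oo = -oo, hence also
   +oo - +oo = -oo - -oo = -oo. *)
Definition hadamard (s1 s2 : counter) : counter :=
  counter_of (@hadamard_homo s1 s2).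

(* x is the greatest counter, for counter_le, such that
   counter_le (hadamard a x) y. *)
Definition is_residual (y a x : counter) : Prop :=
  counter_le (hadamard a x) y /\
  (forall x' : counter, counter_le (hadamard a x') y -> counter_le x' x).

Lemma Zbar_lub (S : set Zbar) :
  exists l, (forall x, S x -> x <= l) /\
            (forall u, (forall x, S x -> x <= u) -> l <= u).
Proof.
pose ub (u : Zbar) := forall x, S x -> x <= u.
have [[n ubn]|nub] := pselect (exists n : int, ub n%:E); last first.
  exists +oo; split=> [x _|[u| |] hu //]; first exact: leey.
    by case: nub; exists u.
  case: nub; exists 0%R => x /hu; rewrite leeNy_eq => /eqP ->.
  exact: leNye.
have [[m Sm]|nS] := pselect (exists m : int, S m%:E); last first.
  exists -oo; split=> [[x| |] Sx|u _]; rewrite ?leNye //.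
    by case: nS; exists x.
  by have := ubn _ Sx.
have exP : exists k : nat, `[< ub (m + k%:Z)%R%:E >].
  exists `|n - m|%N; apply/asboolP.
  have mn : (m <= n)%R by have := ubn _ Sm; rewrite lee_fin.
  by rewrite gez0_abs ?subr_ge0 // [(m + _)%R]addrC subrK.
case: (ex_minnP exP) => k /asboolP ubk kmin.
exists (m + k%:Z)%R%:E; split=> // -[u| |] hu; last 2 first.
- exact: leey.
- by have := hu _ Sm.
have mu : (m <= u)%R by have := hu _ Sm; rewrite lee_fin.
have := kmin `|u - m|%N; rewrite gez0_abs ?subr_ge0 // [(m + _)%R]addrC subrK.
move=> /(_ (asboolT hu)); rewrite lee_fin -lez_nat gez0_abs ?subr_ge0 //.
by rewrite lerBrDl.
Qed.

Lemma adde_residual (a x y : Zbar) : (y <= (a + x)%dE) = (y - a <= x).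
Proof.
case: a x y => [a| |] [x| |] [y| |] //=; rewrite ?leey ?leNye //.
by rewrite -DualAddTheoryNumDomain.dEFinD -EFinB !lee_fin lerBlDl.
Qed.

Lemma residual_exists (y a : counter) : exists x, is_residual y a x.
Proof.
pose S (t : int) : set Zbar :=
  fun z => exists2 s : int, (s <= t)%R & z = y s%:E - a s%:E.
have [f hf] := choice (fun t => Zbar_lub (S t)).
have fhomo : {homo f : x y / (x <= y)%R >-> x <= y}.
  move=> s t st; apply: (hf s).2 => _ [u us ->]; apply: (hf t).1.
  by exists u => //; apply: le_trans st.
exists (counter_of fhomo); split=> [t /=|x' hx' t /=].
  by rewrite adde_residual; apply: (hf t).1; exists t.
apply: (hf t).2 => _ [s st ->].
apply: (@le_trans _ _ (x' s%:E)); last by apply: counter_homo; rewrite lee_fin.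
by rewrite -adde_residual; exact: hx'.
Qed.

Definition residual (y a : counter) : counter :=
  projT1 (cid (residual_exists y a)).

Lemma residualP (y a : counter) : is_residual y a (residual y a).
Proof. exact: projT2 (cid (residual_exists y a)). Qed.

Lemma monomial_homo (n t0 : Zbar) :
  {homo (fun t : int => if t%:E <= t0 then n else +oo) :
    x y / (x <= y)%R >-> x <= y}.
Proof.
move=> x y xy; case: ifP => [_|/negbT xt0]; first by case: ifP; rewrite ?leey.
case: ifP => // yt0; move: xt0; rewrite (le_trans _ yt0) //.
Qed.

(* For all n and t0, monomial +oo t0 and monomial n -oo are the same counter
   (+oo on all of int), so the pair (n, t0) is not unique for that counter. *)
Definition monomial (n t0 : Zbar) : counter :=
  counter_of (@monomial_homo n t0).

(* Main.v *)
(* Residuation turns [y <= a + x] into [y - a <= x], so the residual is the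
   least non-decreasing map above [t |-> y t - a t]. For monomials this
   difference is [nu - nu'] up to [min tau tau'] and [-oo] after [tau'], and it
   is [+oo] (as [nu' <> +oo]) on the integers in between when [tau < tau']. *)
Require Import Defs.
From mathcomp Require Import all_boot all_order all_algebra.
From mathcomp Require Import constructive_ereal.

Import Order.TTheory.

Lemma residual_eq (y a x : counter) :
  is_residual y a x -> residual y a = x.
Proof.
move=> [hx xmax]; have [hr rmax] := residualP y a.
by apply: counter_le_anti; [apply: xmax | apply: rmax].
Qed.

(** Any competitor [x'] has [y s - a s <= x' s <= x' t] for [s <= t], so one earlier witness
    suffices; the value [-oo] needs none. *)
Lemma residual_charact (y a x : counter) :
  (forall t : int, y t%:E - a t%:E <= x t%:E)%E ->
  (forall t : int, x t%:E = -oo%E \/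
    exists2 s : int, (s <= t)%R & (x t%:E <= y s%:E - a s%:E)%E) ->
  residual y a = x.
Proof.
move=> ub lub; apply: residual_eq; split=> [t /=|x' hx' t].
  by rewrite adde_residual.
have [->|[s st xs]] := lub t; first exact: leNye.
apply: (le_trans xs); apply: (@le_trans _ _ (x' s%:E)); last first.
  by apply: counter_homo; rewrite lee_fin.
by rewrite -adde_residual; exact: hx'.
Qed.

Lemma int_min_bound (b : Zbar) (t : int) : b <> -oo%E ->
  exists s : int, s%:E = Order.min t%:E b.
Proof.
case: b => [b| |] // _; last by exists t; rewrite min_l // leey.
have [tb|bt] := leP t%:E b%:E; first by exists t.
by exists b.
Qed.

(** If the divisor is [+oo] on all integers, the residual is [-oo] there; the hypotheses then say
    exactly that the right-hand side is too. *)
Theorem proposition3p4 (nu tau nu' tau' : Zbar)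
    (nu'_pinfty : nu' = +oo%E -> (tau' <= tau)%E)
    (tau'_ninfty : tau' = -oo%E -> nu' = +oo%E \/ nu = -oo%E) :
  residual (monomial nu tau) (monomial nu' tau') =
  if (tau < tau')%E then monomial (nu - nu')%E tau
  else monomial (nu - nu')%E +oo%E.
Proof.
have subey (z : Zbar) : (z - +oo = -oo)%E by case: z.
have [lt_tau|le_tau] := ltP tau tau'.
- have nu'y : nu' <> +oo%E by move/nu'_pinfty; rewrite leNgt lt_tau.
  have tau'Ny : tau' <> -oo%E by move=> e; rewrite e ltNge leNye in lt_tau.
  apply: residual_charact => t /=.
    have [t_tau|_] := leP t%:E tau; last exact: leey.
    by rewrite (le_trans t_tau (ltW lt_tau)).
  right; have [t_tau|tau_t] := leP t%:E tau.
    by exists t => //; rewrite t_tau (le_trans t_tau (ltW lt_tau)).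
  (* As [tau < s <= tau'], the difference at [s] is [+oo - nu' = +oo]. *)
  have [s es] := int_min_bound _ t tau'Ny.
  exists s; first by rewrite -lee_fin es ge_min lexx.
  have -> : (s%:E <= tau)%E = false.
    by apply/negbTE; rewrite -ltNge es lt_min tau_t.
  have -> : (s%:E <= tau')%E by rewrite es ge_min lexx orbT.
  by case: nu' nu'y {nu'_pinfty tau'_ninfty}.
- apply: residual_charact => t /=; rewrite leey.
    have [t_tau'|_] := leP t%:E tau'; last by rewrite subey leNye.
    by rewrite (le_trans t_tau' le_tau).
  have [tau'Ny|/eqP tau'Ny] := eqVneq tau' -oo%E.
    by left; case: (tau'_ninfty tau'Ny) => -> //; case: (nu').
  (* Past [tau'] the difference drops to [-oo], but monotonicity keeps the value [nu - nu'] reached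
     at [s <= tau' <= tau]. *)
  right; have [s es] := int_min_bound _ t tau'Ny.
  exists s; first by rewrite -lee_fin es ge_min lexx.
  have s_tau' : (s%:E <= tau')%E by rewrite es ge_min lexx orbT.
  by rewrite s_tau' (le_trans s_tau' le_tau).
Qed.
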